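(* Let $M$ be a $C^\infty$-manifold and $h$ a $C^\infty$ symmetric $(0,2)$-tensor (a possibly degenerate metric) on $M$. Suppose that $h$ is degenerate at a point $p\in M$ and there exists a $C^\infty$ regular curve $c(t)$ on $M$ (i.e., $\frac{dc}{dt}\neq 0$) such that $c(0)=p$ and $h$ is non-degenerate at every point $c(t)$ with $t>0$. Then, for any $C^\infty$-connection $\nabla$ on $M$, no $C^\infty$-connection $\nabla^{*}$ on $M$ satisfies the equality $$Xh(Y,Z)=h(\nabla_XY,Z)+h(Y,\nabla^{*}_XZ)$$ for $X,Y,Z\in\Gamma(TM)$ at $p$.
   Context: A connection on $M$ means an affine connection on $TM$. The tensor $h$ is degenerate at $p$ if the bilinear form $h_p$ on $T_pM$ has a non-trivial kernel.
   Formalization: ''Satisfies the equality at p'' is read as: for all X, Y, Z the equality holds on some neighbourhood of p; at the single point p the claim fails, e.g. for M = R, h = x² dx², p = 0, c(t) = t and both connections flat. *)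

(* Defs.v *)
From mathcomp Require Import all_boot all_order all_algebra.
From mathcomp Require Import all_classical all_reals all_analysis.

Set Implicit Arguments.
Unset Strict Implicit.
Unset Printing Implicit Defensive.

Import Order.TTheory GRing.Theory Num.Theory.
Import numFieldNormedType.Exports.

Local Open Scope classical_set_scope.
Local Open Scope ring_scope.

(* Functions are total: a map defined on an open set U is represented by any
   extension of it.  The predicate below depends only on the values on U when
   U is open, which is the case in all its uses.  Since V is finite-dimensional
   in these uses, asking that each directional derivative be C^k is asking that
   the differential be C^k. *)
Fixpoint Ck_on (R : realType) (V W : normedModType R) (k : nat) (U : set V)
    (f : V -> W) : Prop :=
  match k with
  | 0 => forall x, U x -> {for x, continuous f}
  | k'.+1 => (forall x, U x -> differentiable f x) /\
             (forall v : V, Ck_on k' U (fun x => 'D_v f x))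
  end.

Definition smooth_on (R : realType) (V W : normedModType R) (U : set V)
    (f : V -> W) : Prop :=
  forall k, Ck_on k U f.

Record chart (R : realType) (n : nat) (M : topologicalType) := Chart {
  chart_dom : set M;
  chart_map :> M -> 'rV[R]_n;
  chart_inv : 'rV[R]_n -> M;
  chart_dom_open : open chart_dom;
  chart_img_open : open (chart_map @` chart_dom);
  chart_mapK : forall q, chart_dom q -> chart_inv (chart_map q) = q;
  chart_map_continuous :
    forall q, chart_dom q -> {for q, continuous chart_map};
  chart_inv_continuous :
    forall x, (chart_map @` chart_dom) x -> {for x, continuous chart_inv}
}.

Definition chart_img (R : realType) (n : nat) (M : topologicalType)
  (phi : chart R n M) : set 'rV[R]_n := phi @` chart_dom phi.

(* The atlas need not be maximal.  The function chart_at only selects, for each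
   point, one chart of the atlas around it; it serves to represent tangent
   vectors (see below) and carries no geometric content. *)
Record manifold (R : realType) (n : nat) := Manifold {
  manifold_space :> topologicalType;
  manifold_hausdorff : hausdorff_space manifold_space;
  manifold_second_countable : @second_countable manifold_space;
  atlas : set (chart R n manifold_space);
  chart_at : manifold_space -> chart R n manifold_space;
  chart_at_atlas : forall p, atlas (chart_at p);
  chart_at_dom : forall p, chart_dom (chart_at p) p;
  atlas_compatible : forall phi psi, atlas phi -> atlas psi ->
    smooth_on (phi @` (chart_dom phi `&` chart_dom psi))
              (psi \o chart_inv phi)
}.

(* T_pM is 'rV[R]_n: the row v stands for the tangent vector at p whose
   components in the chart chart_at p are v.  The components in any other chart
   are obtained with the differential of the change of coordinates. *)
Definition tangent (R : realType) (n : nat) (M : manifold R n) (p : M) :=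
  'rV[R]_n.

Section TangentBundle.
Variables (R : realType) (n : nat) (M : manifold R n).

Definition smooth_function (f : M -> R) : Prop :=
  forall phi, atlas phi -> smooth_on (chart_img phi) (f \o chart_inv phi).

(* components in the chart phi of the tangent vector v at q *)
Definition tangent_coord (phi : chart R n M) (q : M) (v : tangent q) :
    'rV[R]_n :=
  'D_v (phi \o chart_inv (chart_at q)) (chart_at q q).

(* tangent vector at q whose components in the chart phi are u *)
Definition tangent_of (phi : chart R n M) (q : M) (u : 'rV[R]_n) : tangent q :=
  'D_u (chart_at q \o chart_inv phi) (phi q).

Definition vector_field := forall q : M, tangent q.

Definition smooth_field (X : vector_field) : Prop :=
  forall phi, atlas phi ->
    smooth_on (chart_img phi)
      (fun x => tangent_coord phi (X (chart_inv phi x))).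

Definition addf (X Y : vector_field) : vector_field :=
  fun q => (X q : 'rV[R]_n) + Y q.

Definition scalef (f : M -> R) (X : vector_field) : vector_field :=
  fun q => f q *: (X q : 'rV[R]_n).

(* the function X f *)
Definition act (X : vector_field) (f : M -> R) : M -> R :=
  fun q => 'D_(X q : 'rV[R]_n) (f \o chart_inv (chart_at q)) (chart_at q q).

(* The operator is defined on all vector fields but only its values on smooth
   ones, i.e. on Gamma(TM), are constrained. *)
Record connection := Connection {
  cov :> vector_field -> vector_field -> vector_field;
  cov_smooth : forall X Y, smooth_field X -> smooth_field Y ->
    smooth_field (cov X Y);
  cov_addl : forall X X' Y,
    smooth_field X -> smooth_field X' -> smooth_field Y ->
    cov (addf X X') Y = addf (cov X Y) (cov X' Y);
  cov_scalel : forall f X Y,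
    smooth_function f -> smooth_field X -> smooth_field Y ->
    cov (scalef f X) Y = scalef f (cov X Y);
  cov_addr : forall X Y Y',
    smooth_field X -> smooth_field Y -> smooth_field Y' ->
    cov X (addf Y Y') = addf (cov X Y) (cov X Y');
  cov_leibniz : forall f X Y,
    smooth_function f -> smooth_field X -> smooth_field Y ->
    cov X (scalef f Y) = addf (scalef (act X f) Y) (scalef f (cov X Y))
}.

Record sym_tensor := SymTensor {
  tensor_form :> forall q : M, tangent q -> tangent q -> R;
  tensor_sym : forall (q : M) (u v : tangent q),
    tensor_form u v = tensor_form v u;
  tensor_linear : forall (q : M) (u : tangent q),
    scalar (tensor_form u : 'rV[R]_n -> R);
  tensor_smooth : forall phi, atlas phi -> forall u v : 'rV[R]_n,
    smooth_on (chart_img phi)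
      (fun x => tensor_form (tangent_of phi (chart_inv phi x) u)
                            (tangent_of phi (chart_inv phi x) v))
}.

Definition degenerate_at (h : sym_tensor) (q : M) : Prop :=
  exists2 v : tangent q, v <> 0 :> 'rV[R]_n & forall w : tangent q, h q v w = 0.

Definition smooth_curve (I : set R) (c : R -> M) : Prop :=
  (forall t, I t -> {for t, continuous c}) /\
  (forall phi, atlas phi ->
    smooth_on (I `&` c @^-1` chart_dom phi) (phi \o c)).

Definition velocity (c : R -> M) (t : R) : tangent (c t) :=
  'D_1 (chart_at (c t) \o c) t.

Definition regular_curve (I : set R) (c : R -> M) : Prop :=
  smooth_curve I c /\ (forall t, I t -> velocity c t <> 0 :> 'rV[R]_n).

End TangentBundle.

(* Main.v *)
Require Import Defs.
From HB Require Import structures.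
From mathcomp Require Import all_boot all_order all_algebra.
From mathcomp Require Import all_classical all_reals all_analysis.
From mathcomp Require Import perm ring lra.

Set Implicit Arguments.
Unset Strict Implicit.
Unset Printing Implicit Defensive.

Import Order.TTheory GRing.Theory Num.Theory.
Import numFieldNormedType.Exports.

Local Open Scope classical_set_scope.
Local Open Scope ring_scope.

(* If a dual connection nabla' existed, then in a local frame (E_i) extended to
   global fields the Gram matrix S_ij = h(E_i, E_j) would satisfy a linear system
     D_k S = A_k S + S B_k
   near p, where A_k and B_k are built from the components of nabla and nabla'.
   By Jacobi's formula D_k (det S) = (tr A_k + tr B_k) det S, so det S, which
   vanishes at p, vanishes along every short segment issued from p by Gronwall's
   lemma.  Hence h is degenerate on a whole neighbourhood of p, and so at c(t)
   for small t > 0. *)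

(** * Calculus of C^k maps *)

(** The zero map serves as differential, the remainder being identically zero near [x]. Adding such
    a function preserves differentiability, which therefore depends on germs only. *)
Lemma near0_is_diff (R : realType) (V W : normedModType R) (k : V -> W) (x : V) :
  (\forall y \near x, k y = 0) -> differentiable k x.
Proof.
move=> k0.
have dk : k \o shift x = cst (k x) + (cst 0 : V -> W) +o_ 0 id.
  apply/eqaddoP => e e0.
  have H : \forall y \near (0 : V), k (y + x) = 0.
    by move: k0; rewrite (near_shift 0 x) /=; apply: filterS => y; rewrite /= subr0.
  near=> y.
  rewrite /= !fctE/= (nbhs_singleton k0) (near H y)// /cst addr0 subr0 normr0.
  by rewrite mulr_ge0// ltW.
have dk0 : 'd k x = cst 0 :> (V -> W).
  apply: (@diff_unique _ _ _ k (\0 : {linear V -> W})) => //.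
  exact: cst_continuous.
by apply/diff_locallyP; rewrite dk0; split => //; exact: cst_continuous.
Unshelve. all: by end_near. Qed.

Lemma near_eq_differentiable (R : realType) (V W : normedModType R)
    (f g : V -> W) (x : V) :
  (\forall y \near x, f y = g y) -> differentiable f x -> differentiable g x.
Proof.
move=> fg df; have -> : g = f + (g - f) by rewrite addrC subrK.
apply: differentiableD => //; apply: near0_is_diff.
by apply: filterS fg => y; rewrite !fctE => ->; rewrite subrr.
Qed.

(** Scaling is packed as a continuous bilinear map, whose differential at a pair is the product
    rule. *)
Lemma is_diff_scale (R : realType) (V W : normedModType R) (f : V -> R)
    (g : V -> W) (x : V) :
  differentiable f x -> differentiable g x ->
  is_diff x (fun y => f y *: g y) (fun v => f x *: 'd g x v + 'd f x v *: g x).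
Proof.
move=> df dg.
have bil : bilinear_for
    (GRing.Scale.Law.clone _ _ *:%R _) (GRing.Scale.Law.clone _ _ *:%R _)
    (fun (a : R) (w : W) => a *: w).
  split=> [u'|u] a y z /=.
  - by rewrite scalerDl scalerA.
  - by rewrite scalerDr !scalerA mulrC.
pose bM := bilinear_isBilinear.Build R R W W _ _ (fun (a : R) (w : W) => a *: w) bil.
pose b : {bilinear R -> W -> W} := HB.pack (fun (a : R) (w : W) => a *: w) bM.
have bc : continuous (fun p : R * W => b p.1 p.2).
  by move=> p; exact: scale_continuous.
have [/= d1 d2] := (differentiable_bilin (f x, g x) bc, diff_bilin (f x, g x) bc).
apply: DiffDef.
  by apply: (@differentiable_comp _ _ _ _ (fun y => (f y, g y))
    (fun p => p.1 *: p.2)) => //; exact: differentiable_pair.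
rewrite (@diff_comp _ _ _ _ (fun y => (f y, g y)) (fun p => p.1 *: p.2))//; last first.
  exact: differentiable_pair.
by rewrite d2 diff_pair.
Qed.

Lemma Ck_onW (R : realType) (V W : normedModType R) k (U : set V) (f : V -> W) :
  Ck_on k.+1 U f -> Ck_on k U f.
Proof.
elim: k f => [|k IH] f /=.
  by move=> [df _] x Ux; exact/differentiable_continuous/df.
by move=> [df Df]; split => // v; apply: IH; exact: Df.
Qed.

(** Functions equal on an open set have equal directional derivatives there, so the local models [g]
    can be differentiated along with [f]. This permits different formulas for [f] around different
    points. *)
Lemma Ck_on_near_eq (R : realType) (V W : normedModType R) k (U : set V)
    (f : V -> W) :
  (forall x, U x -> exists U' (g : V -> W),
    [/\ open U', U' x, Ck_on k U' g & forall y, U' y -> f y = g y]) ->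
  Ck_on k U f.
Proof.
have near_eq (x : V) (U' : set V) (f' g' : V -> W) : open U' -> U' x ->
    (forall y, U' y -> f' y = g' y) -> \forall y \near x, f' y = g' y.
  by move=> oU' U'x fg; apply: filterS (open_nbhs_nbhs (conj oU' U'x)).
elim: k f => [|k IH] f loc /=.
  move=> x /loc[U' [g [oU' U'x gc fg]]].
  rewrite /prop_for /continuous_at (fg _ U'x); apply: cvg_trans (gc _ U'x).
  by apply: near_eq_cvg; apply: (near_eq _ _ _ _ oU' U'x) => y /fg.
split=> [x /loc[U' [g [oU' U'x [dg _] fg]]]|v].
  apply: near_eq_differentiable (dg _ U'x).
  by apply: (near_eq _ _ _ _ oU' U'x) => y /fg.
apply: IH => x /loc[U' [g [oU' U'x [_ Dg] fg]]].
exists U', (fun y => 'D_v g y); split => //; first exact: Dg.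
move=> y U'y; apply: near_eq_derive; exact: (near_eq _ _ _ _ oU' U'y fg).
Qed.

Lemma Ck_on_eq (R : realType) (V W : normedModType R) k (U : set V)
    (f g : V -> W) :
  open U -> (forall x, U x -> g x = f x) -> Ck_on k U f -> Ck_on k U g.
Proof. by move=> oU gf fk; apply: Ck_on_near_eq => x Ux; exists U, f. Qed.

Lemma Ck_on_subset (R : realType) (V W : normedModType R) k (U U' : set V)
    (f : V -> W) : U' `<=` U -> Ck_on k U f -> Ck_on k U' f.
Proof.
elim: k f => [|k IH] f U'U /=; first by move=> fc x /U'U /fc.
by move=> [df Df]; split=> [x /U'U /df //|v]; exact: IH.
Qed.

Lemma Ck_on_cst (R : realType) (V W : normedModType R) k (U : set V) (w : W) :
  Ck_on k U (cst w : V -> W).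
Proof.
elim: k w => [|k IH] w /=; first by move=> x _; exact: cst_continuous.
split=> [x _|v]; first exact: differentiable_cst.
rewrite (_ : (fun x => _) = cst 0) //.
by apply/funext => x; rewrite derive_cst.
Qed.

Lemma Ck_onD (R : realType) (V W : normedModType R) k (U : set V)
    (f g : V -> W) : open U ->
  Ck_on k U f -> Ck_on k U g -> Ck_on k U (fun x => f x + g x).
Proof.
move=> oU; elim: k f g => [|k IH] f g /=.
  by move=> fc gc x Ux; apply: cvgD; [exact: fc|exact: gc].
move=> [df Df] [dg Dg]; split=> [x Ux|v].
  by apply: differentiableD; [exact: df|exact: dg].
apply: Ck_on_eq oU _ (IH _ _ (Df v) (Dg v)) => x Ux.
by rewrite deriveD//; apply: diff_derivable; [exact: df|exact: dg].
Qed.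

Lemma Ck_on_sum (R : realType) (V W : normedModType R) k (U : set V)
    (I : Type) (r : seq I) (F : I -> V -> W) : open U ->
  (forall i, Ck_on k U (F i)) -> Ck_on k U (fun x => \sum_(i <- r) F i x).
Proof.
move=> oU Fk; elim: r => [|i r IH].
  by apply: Ck_on_eq oU _ (Ck_on_cst _ _ 0) => x _; rewrite big_nil.
by apply: Ck_on_eq oU _ (Ck_onD oU (Fk i) IH) => x _; rewrite big_cons.
Qed.

(** The product rule leaves one factor undifferentiated; [Ck_onW] lowers its order by one so that
    the induction hypothesis applies. *)
Lemma Ck_on_scale (R : realType) (V W : normedModType R) k (U : set V)
    (f : V -> R) (g : V -> W) : open U ->
  Ck_on k U f -> Ck_on k U g -> Ck_on k U (fun x => f x *: g x).
Proof.
move=> oU; elim: k f g => [|k IH] f g.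
  by move=> fc gc x Ux; apply: cvgZ; [exact: fc|exact: gc].
move=> fk gk; have [[df Df] [dg Dg]] := (fk, gk); split=> [x Ux|v].
  by have fgd := is_diff_scale (df x Ux) (dg x Ux); exact: ex_diff.
have H := Ck_onD oU (IH _ _ (Ck_onW fk) (Dg v)) (IH _ _ (Df v) (Ck_onW gk)).
apply: Ck_on_eq oU _ H => x Ux.
have fgd := is_diff_scale (df x Ux) (dg x Ux).
by rewrite deriveE// diff_val !deriveE//; [exact: df|exact: dg].
Qed.

Lemma Ck_onM (R : realType) (V : normedModType R) k (U : set V)
    (f g : V -> R) : open U ->
  Ck_on k U f -> Ck_on k U g -> Ck_on k U (fun x => f x * g x).
Proof. exact: Ck_on_scale. Qed.

Lemma Ck_on_prod (R : realType) (V : normedModType R) k (U : set V)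
    (I : Type) (r : seq I) (F : I -> V -> R) : open U ->
  (forall i, Ck_on k U (F i)) -> Ck_on k U (fun x => \prod_(i <- r) F i x).
Proof.
move=> oU Fk; elim: r => [|i r IH].
  by apply: Ck_on_eq oU _ (@Ck_on_cst R V R k U 1) => x _; rewrite big_nil.
by apply: Ck_on_eq oU _ (Ck_onM oU (Fk i) IH) => x _; rewrite big_cons.
Qed.

Lemma Ck_on_det (R : realType) (V : normedModType R) k (U : set V) m
    (S : V -> 'M[R]_m) : open U ->
  (forall i j, Ck_on k U (fun x => S x i j)) ->
  Ck_on k U (fun x => \det (S x)).
Proof.
move=> oU Sk; apply: Ck_on_sum => // s; apply: Ck_onM => //.
  exact: (@Ck_on_cst R V R k U ((-1) ^+ s)).
exact: Ck_on_prod.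
Qed.

Lemma derive_coord (R : realType) (V : normedModType R) m (f : V -> 'rV[R]_m)
    (x v : V) (i : 'I_m) :
  differentiable f x -> 'D_v (fun y => f y 0 i) x = 'D_v f x 0 i.
Proof. by move=> df; rewrite derive_mx ?mxE//; exact: diff_derivable. Qed.

Lemma Ck_on_coord (R : realType) (V : normedModType R) k (U : set V)
    m (f : V -> 'rV[R]_m) (i : 'I_m) : open U ->
  Ck_on k U f -> Ck_on k U (fun x => f x 0 i).
Proof.
move=> oU; elim: k f => [|k IH] f /=.
  move=> fc x Ux; apply: (@cvg_comp _ _ _ f (fun w : 'rV[R]_m => w 0 i)).
    exact: fc.
  exact: coord_continuous.
move=> [df Df]; split=> [x Ux|v].
  apply: (@differentiable_comp _ _ _ _ f (fun w : 'rV[R]_m => w 0 i)).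
    exact: df.
  exact: differentiable_coord.
by apply: Ck_on_eq oU _ (IH _ (Df v)) => x Ux; rewrite derive_coord//; exact: df.
Qed.

Lemma Ck_on_id (R : realType) (V : normedModType R) k (U : set V) :
  Ck_on k U (id : V -> V).
Proof.
case: k => [|k] /=; first by move=> x _; exact: cvg_id.
split=> [x _|v]; first exact: ex_diff.
rewrite (_ : (fun x => _) = cst v); first exact: Ck_on_cst.
by apply/funext => x; rewrite derive_id.
Qed.

Lemma derive_comp (R : realType) (V W Z : normedModType R) (f : V -> W)
    (g : W -> Z) (x v : V) :
  differentiable f x -> differentiable g (f x) ->
  'D_v (g \o f) x = 'D_('D_v f x) g (f x).
Proof.
move=> df dg; rewrite !deriveE//; last exact: differentiable_comp.
by rewrite diff_comp.
Qed.

Lemma derive_row_sum (R : realType) (W : normedModType R) m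
    (g : 'rV[R]_m -> W) (x v : 'rV[R]_m) :
  differentiable g x ->
  'D_v g x = \sum_i v 0 i *: 'D_(delta_mx 0 i) g x.
Proof.
move=> dg; rewrite deriveE// {1}(row_sum_delta v) linear_sum.
by apply: eq_bigr => i _; rewrite linearZ deriveE.
Qed.

(** The chain rule differentiates [g] in a direction that varies with the point, while [Ck_on]
    speaks of fixed directions. Expanding the direction in the standard basis of ['rV[R]_m] leaves a
    sum of products covered by induction. *)
Lemma Ck_on_comp (R : realType) (V W : normedModType R) m k (U : set V)
    (U' : set 'rV[R]_m) (f : V -> 'rV[R]_m) (g : 'rV[R]_m -> W) :
  open U -> (forall x, U x -> U' (f x)) ->
  Ck_on k U f -> Ck_on k U' g -> Ck_on k U (g \o f).
Proof.
move=> oU UU'; elim: k f g UU' => [|k IH] f g UU'.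
  move=> fc gc x Ux; apply: continuous_comp; first exact: fc.
  exact/gc/UU'.
move=> fk [dg Dg]; have [df Df] := fk; split=> [x Ux|v].
  by apply: differentiable_comp; [exact: df|exact/dg/UU'].
have H := Ck_on_sum (index_enum _) oU (fun i => Ck_on_scale oU (Ck_on_coord i oU (Df v))
  (IH _ _ UU' (Ck_onW fk) (Dg (delta_mx 0 i)))).
apply: Ck_on_eq oU _ H => x Ux.
rewrite derive_comp; [|exact: df|exact/dg/UU'].
by rewrite derive_row_sum//; exact/dg/UU'.
Qed.

(** * A smooth bump function *)

(** The exponent [m] is a parameter because differentiation stays inside the linear span of the
    family; [flat 0] is the classical smooth function with all derivatives zero at the origin. *)
Definition flat (R : realType) (m : nat) (t : R) : R :=
  if 0 < t then t^-1 ^+ m * expR (- t^-1) else 0.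

Lemma flat_ge0 (R : realType) m (t : R) : 0 <= flat m t.
Proof.
by rewrite /flat; case: ifP => // t0;
  rewrite mulr_ge0 ?expR_ge0 ?exprn_ge0 ?invr_ge0 ?ltW.
Qed.

(** With [s = 1/t], the exponential series gives [s^(m+2) / (m+2)! <= exp s]. The two spare powers
    of [t] make the derivative at the origin vanish. *)
Lemma flat_le_sqr (R : realType) m (t : R) :
  flat m t <= m.+2`!%:R * t ^+ 2.
Proof.
rewrite /flat; case: ifP => [t0|_]; last by rewrite mulr_ge0 ?sqr_ge0.
have s0 : 0 < t^-1 by rewrite invr_gt0.
have F0 : 0 < m.+2`!%:R :> R by rewrite ltr0n fact_gt0.
have := expR_ge1Dxn m.+1 (ltW s0).
rewrite expRN => H.
rewrite ler_pdivrMr ?expR_gt0//.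
have : t^-1 ^+ m.+2 / m.+2`!%:R <= expR t^-1 by apply: le_trans H; lra.
rewrite ler_pdivrMr// => H2.
rewrite mulrAC (mulrC _ (expR _)) -ler_pdivrMr ?exprn_gt0//.
by rewrite -exprVn -exprD addn2.
Qed.

Lemma is_derive0_sqr (R : realType) (f : R -> R) (C : R) :
  f 0 = 0 -> (forall t, `|f t| <= C * t ^+ 2) -> is_derive (0 : R) (1 : R) f 0.
Proof.
move=> f0 fC.
have C0 : 0 <= C by have := fC 1; rewrite expr1n mulr1; exact: le_trans.
(* [C] may be zero, so [C + 1] is the divisor that fixes the size of the neighbourhood. *)
have C1 : 0 < C + 1 by lra.
suff H : h^-1 *: (f (h *: (1 : R) + 0) - f 0) @[h --> 0^'] --> (0 : R).
  by apply: DeriveDef; [apply/cvg_ex; exists 0|exact: cvg_lim].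
apply/cvgrPdist_le => e e0; near=> h.
have h0 : h != 0 by near: h; exact: nbhs_dnbhs_neq.
rewrite sub0r normrN f0 subr0 addr0 /GRing.scale /= mulr1 normrM normfV.
rewrite ler_pdivrMl ?normr_gt0//; apply: le_trans (fC h) _.
rewrite -real_normK ?num_real// expr2 mulrCA ler_wpM2l//.
apply: (@le_trans _ _ ((C + 1) * `|h|)).
  by rewrite ler_wpM2r//; lra.
rewrite -ler_pdivlMl//; near: h; apply: dnbhs0_le.
by rewrite mulr_gt0 ?invr_gt0.
Unshelve. all: by end_near. Qed.

(** Away from the origin this is ordinary calculus on each branch. At the origin the formula is
    zero, as is the derivative by the quadratic bound [flat_le_sqr]. *)
Lemma is_derive_flat (R : realType) m (t : R) :
  is_derive t 1 (flat m) (flat m.+2 t - m%:R * flat m.+1 t).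
Proof.
case: (ltgtP t 0) => [t0|t0|->].
- rewrite /flat ltNge (ltW t0)/= mulr0 subrr.
  apply: (@near_eq_is_derive _ _ _ (cst 0)).
  near=> s; rewrite ltNge ltW//.
  by near: s; exact: lt_nbhsl.
- rewrite /flat t0.
  pose V (s : R) := s^-1.
  apply: (@near_eq_is_derive _ _ _ (V ^+ m * (expR \o (- V)))).
    near=> s; rewrite ifT ?exprfctE//.
    by near: s; exact: lt_nbhsr.
  have t0' : t != 0 by rewrite gt_eqF.
  have dV : is_derive t 1 V (- t ^- 2).
    by have := @is_deriveV _ id t 1 1 t0' _; rewrite /GRing.scale/= mulr1; apply.
  have dX := @is_deriveX _ _ V m t 1 _ dV.
  have dE := @is_derive1_comp _ expR (- V) t _ _ (is_derive_expR _) (is_deriveN dV).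
  apply: (is_derive_eq (is_deriveM dX dE)).
  rewrite exprfctE /V /GRing.scale /=.
  case: m {dX dE} => [|m]; rewrite !fctE.
    by rewrite !expr0 /GRing.scale/=; field.
  by rewrite /GRing.scale /= !exprS; field.
- rewrite /flat ltxx mulr0 subrr.
  apply: is_derive0_sqr => [|s]; first by rewrite /flat ltxx.
  by rewrite ger0_norm ?flat_ge0//; exact: flat_le_sqr.
Unshelve. all: by end_near. Qed.

(** The induction on [k] keeps [m] general, since differentiating [flat m] brings in [flat m.+1] and
    [flat m.+2]. *)
Lemma Ck_on_flat (R : realType) (V : normedModType R) k (U : set V)
    (g : V -> R) m : open U ->
  Ck_on k U g -> Ck_on k U (fun x => flat m (g x)).
Proof.
move=> oU; elim: k m => [|k IH] m gk.
  move=> x Ux; apply: (@continuous_comp _ _ _ g (flat m)); first exact: gk.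
  have [dF _] := is_derive_flat m (g x).
  exact/differentiable_continuous/derivable1_diffP.
have dF s : differentiable (flat m : R -> R) s.
  by apply/derivable1_diffP; case: (is_derive_flat m s).
have [dg Dg] := gk; split=> [x Ux|v].
  by apply: (@differentiable_comp _ _ _ _ g (flat m)) => //; exact: dg.
have gk' := Ck_onW gk.
have H := Ck_onM oU (Ck_onD oU (IH m.+2 gk')
  (Ck_onM oU (@Ck_on_cst R V R k U (- m%:R)) (IH m.+1 gk'))) (Dg v).
apply: Ck_on_eq oU _ H => x Ux.
rewrite (@derive_comp _ _ _ _ g (flat m))//; last exact: dg.
(* The direction is the real number ['D_v g x]; by linearity it factors out of the derivative along
   1. *)
rewrite deriveE// -[X in 'd _ _ X]mulr1 linearZ -deriveE//.
have [_ ->] := is_derive_flat m (g x).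
by rewrite /= mulNr; exact: mulrC.
Qed.

(** The squared Euclidean distance is used because the norm of ['rV[R]_n] is the maximum norm, which
    is not smooth in general. *)
Definition flat_bump (R : realType) n (a : 'rV[R]_n) (r : R) (x : 'rV[R]_n) : R :=
  flat 0 (r ^+ 2 - \sum_i (x 0 i - a 0 i) ^+ 2).

Lemma Ck_on_flat_bump (R : realType) n (a : 'rV[R]_n) (r : R) k :
  Ck_on k setT (flat_bump a r).
Proof.
apply: Ck_on_flat; first exact: openT.
pose d i (x : 'rV[R]_n) := x 0 i + - a 0 i.
have dk i : Ck_on k setT (d i).
  apply: Ck_onD; first exact: openT.
    by apply: Ck_on_coord; [exact: openT|exact: Ck_on_id].
  exact: Ck_on_cst.
have sk : Ck_on k setT (fun x => \sum_i d i x * d i x).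
  by apply: Ck_on_sum => [|i]; [exact: openT|apply: Ck_onM => //; exact: openT].
have := Ck_onD openT (@Ck_on_cst R _ R k setT (r ^+ 2))
  (Ck_onM openT (@Ck_on_cst R _ R k setT (-1)) sk).
apply: Ck_on_eq => [|x _]; first exact: openT.
by rewrite mulN1r; congr (_ - _); apply: eq_bigr => i _; rewrite expr2.
Qed.

Lemma flat_bump_gt0_near (R : realType) n (a : 'rV[R]_n) (r : R) : 0 < r ->
  \forall x \near a, 0 < flat_bump a r x.
Proof.
move=> r0; have bc : {for a, continuous (flat_bump a r)}.
  exact: (Ck_on_flat_bump a r 0).
apply: (cvgr_gt _ bc).
rewrite /flat_bump big1 => [|i _]; last by rewrite subrr expr0n.
by rewrite subr0 /flat exprn_gt0// mul1r expR_gt0.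
Qed.

(** The Euclidean ball lies in the ball of the maximum norm, each squared coordinate being at most
    the sum of all of them. *)
Lemma flat_bump_neq0 (R : realType) n (a : 'rV[R]_n) (r : R) x : 0 < r ->
  flat_bump a r x != 0 -> closed_ball a r x.
Proof.
move=> r0; rewrite /flat_bump /flat; case: ifP; last by rewrite eqxx.
rewrite subr_gt0 => sr _; rewrite closed_ballE// /closed_ball_ /=.
rewrite /Num.Def.normr/= mx_normrE bigmax_le ?ltW// => -[i j] _.
rewrite /= ord1 !mxE distrC -ler_sqr ?nnegrE ?normr_ge0 ?ltW// real_normK ?num_real//.
apply: le_lt_trans sr; rewrite (bigD1 j)//= lerDl.
by apply: sumr_ge0 => k _; exact: sqr_ge0.
Qed.

(** * Derivative of a determinant and Gronwall's lemma *)

Lemma is_derive_prod (R : realType) (V : normedModType R) m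
    (f : 'I_m -> V -> R) (df : 'I_m -> R) (x v : V) :
  (forall i, is_derive x v (f i) (df i)) ->
  is_derive x v (fun y => \prod_i f i y)
    (\sum_i \prod_j (if j == i then df j else f j x)).
Proof.
elim: m f df => [|m IH] f df fdf.
  rewrite big_ord0 (_ : (fun y => _) = cst 1); first exact: is_derive_cst.
  by apply/funext => y; rewrite big_ord0.
rewrite (_ : (fun y => _) =
    (fun y => \prod_i f (widen_ord (leqnSn m) i) y) * f ord_max); last first.
  by apply/funext => y; rewrite big_ord_recr.
have IH' := IH _ _ (fun i => fdf (widen_ord (leqnSn m) i)).
apply: (is_derive_eq (is_deriveM IH' (fdf ord_max))).
rewrite big_ord_recr /= [RHS]addrC; congr (_ + _).
  rewrite big_ord_recr /= eqxx /GRing.scale/=; congr (_ * _).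
  by apply: eq_bigr => i _; rewrite -val_eqE /= ltn_eqF.
rewrite /GRing.scale/= mulr_sumr; apply: eq_bigr => i _.
rewrite big_ord_recr /= mulrC -[in RHS]val_eqE /= gtn_eqF//.
Qed.

Lemma is_derive_bigsum (R : realType) (V W : normedModType R) (I : Type)
    (r : seq I) (F : I -> V -> W) (dF : I -> W) (x v : V) :
  (forall i, is_derive x v (F i) (dF i)) ->
  is_derive x v (fun y => \sum_(i <- r) F i y) (\sum_(i <- r) dF i).
Proof.
move=> FdF; elim: r => [|i r IH].
  rewrite big_nil (_ : (fun y => _) = cst 0); first exact: is_derive_cst.
  by apply/funext => y; rewrite big_nil.
rewrite big_cons (_ : (fun y => _) = F i + (fun y => \sum_(i <- r) F i y)).
  exact: is_deriveD.
by apply/funext => y; rewrite big_cons.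
Qed.

(** Jacobi's formula. The adjugate keeps it valid where [S x] is singular, as the Gram matrix is at
    [p]. *)
Lemma is_derive_det (R : realType) (V : normedModType R) m
    (S : V -> 'M[R]_m) (dS : 'M[R]_m) (x v : V) :
  (forall i j, is_derive x v (fun y => S y i j) (dS i j)) ->
  is_derive x v (fun y => \det (S y)) (\tr (\adj (S x) *m dS)).
Proof.
move=> SdS.
pose row_repl i := \matrix_(k, j) (if k == i then dS k j else S x k j).
have H (s : {perm 'I_m}) : is_derive x v
    (fun y => (-1) ^+ s * \prod_i S y i (s i))
    ((-1) ^+ s * \sum_i \prod_j (if j == i then dS j (s j) else S x j (s j))).
  by apply: is_deriveZ; exact: is_derive_prod.
apply: (is_derive_eq (is_derive_bigsum _ H)).
(* Differentiating the Leibniz expansion replaces one row at a time by its derivative. *)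
transitivity (\sum_i \det (row_repl i)).
  rewrite /determinant exchange_big /=; apply: eq_bigr => s _.
  rewrite [LHS]mulr_sumr; apply: eq_bigr => i _; congr (_ * _).
  by apply: eq_bigr => j _; rewrite mxE.
rewrite /mxtrace; under [RHS]eq_bigr do rewrite mxE.
rewrite [RHS]exchange_big /=; apply: eq_bigr => i _.
(* The cofactors along row [i] do not see the replaced row, so they are those of [S x]. *)
rewrite (expand_det_row _ i); apply: eq_bigr => j _.
rewrite !mxE eqxx mulrC /cofactor; congr (_ * \det _ * _).
by apply/matrixP => k l; rewrite !mxE eq_sym (negbTE (neq_lift _ _)).
Qed.

(** The trace is cyclic, and [S] times its adjugate on either side is [\det S] times the identity;
    no inverse of [S] enters. *)
Lemma mxtrace_adj_mul (R : comNzRingType) m (S A B : 'M[R]_m) :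
  \tr (\adj S *m (A *m S + S *m B)) = (\tr A + \tr B) * \det S.
Proof.
rewrite mulmxDr raddfD /= [in X in X + _]mxtrace_mulC -!mulmxA mul_mx_adj.
rewrite mul_mx_scalar mxtraceZ mulmxA mul_adj_mx mul_scalar_mx mxtraceZ.
by rewrite mulrDl ![\det S * _]mulrC.
Qed.

(* Gronwall's argument along the segment from [a] to [x]. *)
Lemma gradient_bound_eq0 (R : realType) (V : normedModType R) (f : V -> R)
    (a : V) (C : R) : f a = 0 ->
  (\forall x \near a, differentiable f x /\
     forall v, `|'D_v f x| <= C * `|v| * `|f x|) ->
  \forall x \near a, f x = 0.
Proof.
move=> fa /nbhs_ballP[e /= e0 fe]; apply/nbhs_ballP; exists e => //= x ax.
pose l (s : R) := a + s *: (x - a).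
have lball (s : R) : 0 <= s <= 1 -> ball a e (l s).
  move=> /andP[s0 s1]; move: ax; rewrite -!ball_normE /ball_/= => ax.
  rewrite /l opprD addrA subrr sub0r normrN normrZ ger0_norm// distrC.
  by apply: le_lt_trans ax; rewrite ler_piMl.
have dl (s : R) : is_diff s l (fun t => t *: (x - a)).
  apply: (is_diff_eq (is_diffD (is_diff_cst a s) (is_diff_scalel s (x - a)))).
  by apply/funext => t; rewrite !fctE add0r.
pose g (s : R) := f (l s).
pose K := C * `|x - a|.
have dg (s : R) : 0 <= s <= 1 -> is_derive s 1 g ('D_(x - a) f (l s)).
  move=> /lball /fe [df _].
  apply: DeriveDef; first exact/derivable1_diffP/(@differentiable_comp _ _ _ _ l f).
  by rewrite (@derive_comp _ _ _ _ l f)//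
    (deriveE _ (@ex_diff _ _ _ _ _ _ _ (dl s))) diff_val scale1r.
pose h (s : R) := - (2 * K) * s.
have dh (s : R) : is_derive s 1 h (- (2 * K)).
  have := is_deriveZ (- (2 * K)) (is_derive_id s (1 : R)).
  by rewrite /GRing.scale/= mulr1.
(* Squaring [g] avoids differentiating an absolute value; the weight [exp(-2Ks)] turns
   [g g' <= K g^2] into the monotonicity of [w]. *)
pose w := g * g * (expR \o h).
have dw (s : R) : 0 <= s <= 1 -> is_derive s 1 w
   ((2 * g s * 'D_(x - a) f (l s) - 2 * K * g s ^+ 2) * expR (h s)).
  move=> s01; have gs := dg s s01.
  apply: (is_derive_eq (is_deriveM (is_deriveM gs gs)
    (is_derive1_comp (is_derive_expR (h s)) (dh s)))).
  by rewrite /GRing.scale/= !fctE; ring.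
have : w 1 <= w 0.
  have sub (s : R) : s \in `]0, 1[ -> 0 <= s <= 1.
    by rewrite in_itv/= => /andP[/ltW-> /ltW->].
  apply: (@ler0_derive1_le_cc _ w 0 1); rewrite ?in_itv/= ?lexx ?ler01//.
  - by move=> s /sub /dw[].
  - move=> s /sub s01; have [_ ws] := dw s s01; rewrite derive1E ws.
    rewrite pmulr_lle0 ?expR_gt0//.
    have [_ /(_ (x - a))] := fe _ (lball s s01).
    rewrite -/(g s) -/K => Kg.
    suff : g s * 'D_(x - a) f (l s) <= K * g s ^+ 2 by lra.
    apply: le_trans (ler_norm _) _; rewrite normrM.
    apply: (le_trans (ler_wpM2l (normr_ge0 _) Kg)).
    by rewrite mulrCA -expr2 real_normK ?num_real.
  - apply/continuous_in_subspaceT => s; rewrite inE/= in_itv/= => /dw[dws _].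
    exact/differentiable_continuous/derivable1_diffP.
have -> : w 0 = 0 by rewrite /w !fctE /g /l scale0r addr0 fa !mul0r.
rewrite /w !fctE pmulr_lle0 ?expR_gt0// -expr2 => g1.
have : g 1 == 0 by rewrite -sqrf_eq0 eq_le g1 sqr_ge0.
by rewrite /g /l scale1r addrC subrK => /eqP.
Qed.

(** * Tangent vectors in charts *)

Section Charts.
Context (R : realType) (n : nat) (M : manifold R n).
Implicit Types (phi psi chi : chart R n M) (q : M).

Lemma chart_inv_dom phi x : chart_img phi x -> chart_dom phi (chart_inv phi x).
Proof. by move=> [q qphi <-]; rewrite chart_mapK. Qed.

Lemma chart_invK phi x : chart_img phi x -> phi (chart_inv phi x) = x.
Proof. by move=> [q qphi <-]; rewrite chart_mapK. Qed.

Lemma chart_img_map phi q : chart_dom phi q -> chart_img phi (phi q).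
Proof. by move=> qphi; exists q. Qed.

(** Inside the open image of [phi], this set is the preimage of [O] under the continuous inverse
    chart. It makes the domains of transition maps open. *)
Lemma open_chart_map phi (O : set M) : open O ->
  open (phi @` (chart_dom phi `&` O)).
Proof.
move=> oO; rewrite openE => _ [q [qphi Oq] <-]; rewrite /interior.
have imgq := chart_img_map qphi.
have nO : \forall x \near phi q, O (chart_inv phi x).
  have := chart_inv_continuous imgq; apply.
  by rewrite chart_mapK//; exact: open_nbhs_nbhs.
have nimg := open_nbhs_nbhs (conj (@chart_img_open _ _ _ phi) imgq).
apply: filterS2 nO nimg => x Ox imgx.
exists (chart_inv phi x); last exact: chart_invK.
by split => //; exact: chart_inv_dom.
Qed.

Lemma near_chart_dom phi psi q : chart_dom phi q -> chart_dom psi q ->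
  \forall x \near phi q, chart_img phi x /\ chart_dom psi (chart_inv phi x).
Proof.
move=> qphi qpsi.
have oU := open_chart_map (phi := phi) (@chart_dom_open _ _ _ psi).
apply: filterS (open_nbhs_nbhs (conj oU _)); last by exists q.
by move=> x [q' [q'phi q'psi] <-]; rewrite chart_mapK//; split => //; exists q'.
Qed.

Lemma transition_differentiable phi psi q : atlas phi -> atlas psi ->
  chart_dom phi q -> chart_dom psi q ->
  differentiable (psi \o chart_inv phi) (phi q).
Proof.
move=> aphi apsi qphi qpsi.
by have [+ _] := atlas_compatible aphi apsi 1; apply; exists q.
Qed.

(** The chain rule, applied to germs: off the overlap the total functions representing charts are
    arbitrary. Taking for [f] a real function, another chart or [chart_at q] gives the coordinate
    formulas that follow. *)
Lemma derive_change_chart (W : normedModType R) phi psi q (f : M -> W) v :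
  atlas phi -> atlas psi -> chart_dom phi q -> chart_dom psi q ->
  differentiable (f \o chart_inv psi) (psi q) ->
  'D_v (f \o chart_inv phi) (phi q) =
  'D_('D_v (psi \o chart_inv phi) (phi q)) (f \o chart_inv psi) (psi q).
Proof.
move=> aphi apsi qphi qpsi df.
have tq : (psi \o chart_inv phi) (phi q) = psi q by rewrite /= chart_mapK.
rewrite -[in RHS]tq -(@derive_comp _ _ _ _ (psi \o chart_inv phi)); last 2 first.
- exact: transition_differentiable.
- by rewrite tq.
apply: near_eq_derive; apply: filterS (near_chart_dom qphi qpsi) => x [_ xpsi].
by rewrite /= chart_mapK.
Qed.

Lemma actE phi q (X : vector_field M) (f : M -> R) : atlas phi ->
  chart_dom phi q -> differentiable (f \o chart_inv phi) (phi q) ->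
  act X f q = 'D_(tangent_coord phi (X q)) (f \o chart_inv phi) (phi q).
Proof.
by move=> aphi qphi df; apply: derive_change_chart => //;
  [exact: chart_at_atlas|exact: chart_at_dom].
Qed.

Lemma tangent_coord_of phi psi q (u : 'rV[R]_n) : atlas phi -> atlas psi ->
  chart_dom phi q -> chart_dom psi q ->
  tangent_coord psi (tangent_of phi q u) =
  'D_u (psi \o chart_inv phi) (phi q).
Proof.
move=> aphi apsi qphi qpsi; apply/esym/derive_change_chart => //.
- exact: chart_at_atlas.
- exact: chart_at_dom.
- by apply: transition_differentiable => //;
    [exact: chart_at_atlas|exact: chart_at_dom].
Qed.

Lemma derive_chart_id phi q (u : 'rV[R]_n) : chart_dom phi q ->
  'D_u (phi \o chart_inv phi) (phi q) = u.
Proof.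
move=> qphi; rewrite -[RHS](derive_id (phi q) u); apply: near_eq_derive.
apply: filterS (open_nbhs_nbhs (conj (@chart_img_open _ _ _ phi) (chart_img_map qphi))).
by move=> x; exact: chart_invK.
Qed.

Lemma tangent_ofK phi q (u : 'rV[R]_n) : atlas phi -> chart_dom phi q ->
  tangent_coord phi (tangent_of phi q u) = u.
Proof. by move=> aphi qphi; rewrite tangent_coord_of// derive_chart_id. Qed.

Lemma tangent_coordK phi q (v : tangent q) : atlas phi -> chart_dom phi q ->
  tangent_of phi q (tangent_coord phi v) = v.
Proof.
(* [v] is rewritten as the derivative along [v] of [chart_at q] read in itself, to which the change
   of chart applies. *)
move=> aphi qphi; rewrite -[RHS](derive_chart_id v (chart_at_dom q)).
apply/esym/derive_change_chart => //.
- exact: chart_at_atlas.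
- exact: chart_at_dom.
- by apply: transition_differentiable => //;
    [exact: chart_at_atlas|exact: chart_at_dom].
Qed.

Lemma tangent_coordZ phi q (b : R) (v : tangent q) : atlas phi ->
  chart_dom phi q ->
  tangent_coord phi (b *: (v : 'rV[R]_n) : tangent q) = b *: tangent_coord phi v.
Proof.
move=> aphi qphi; rewrite /tangent_coord.
have d : differentiable (phi \o chart_inv (chart_at q)) (chart_at q q).
  by apply: transition_differentiable => //;
    [exact: chart_at_atlas|exact: chart_at_dom].
by rewrite !deriveE// linearZ.
Qed.

Lemma tangent_ofZ phi q (b : R) (u : 'rV[R]_n) : atlas phi ->
  chart_dom phi q ->
  tangent_of phi q (b *: u) = b *: (tangent_of phi q u : 'rV[R]_n).
Proof.
move=> aphi qphi; rewrite /tangent_of.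
have d : differentiable (chart_at q \o chart_inv phi) (phi q).
  by apply: transition_differentiable => //;
    [exact: chart_at_atlas|exact: chart_at_dom].
by rewrite !deriveE// linearZ.
Qed.

Lemma tangent_of_sum phi q (u : 'rV[R]_n) : atlas phi -> chart_dom phi q ->
  tangent_of phi q u = \sum_i u 0 i *: (tangent_of phi q (delta_mx 0 i) : 'rV[R]_n).
Proof.
move=> aphi qphi; apply: derive_row_sum.
by apply: transition_differentiable => //;
  [exact: chart_at_atlas|exact: chart_at_dom].
Qed.

(** * Linear algebra of the tensor at a point *)

Lemma tensor0r (h : sym_tensor M) q (w : 'rV[R]_n) : h q w (0 : 'rV[R]_n) = 0.
Proof.
have lin := tensor_linear h (q := q) w.
by have := lin (-1) 0 0; rewrite scaler0 addr0 mulN1r addNr.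
Qed.

Lemma tensor_sumr (h : sym_tensor M) q (c : 'I_n -> R) (e : 'I_n -> 'rV[R]_n)
    (w : 'rV[R]_n) :
  h q w (\sum_i c i *: e i) = \sum_i c i * h q w (e i).
Proof.
have lin := tensor_linear h (q := q) w.
elim/big_rec2: _ => [|i x y _ <-]; first exact: tensor0r.
by rewrite lin.
Qed.

Lemma tensor_suml (h : sym_tensor M) q (c : 'I_n -> R) (e : 'I_n -> 'rV[R]_n)
    (w : 'rV[R]_n) :
  h q (\sum_i c i *: e i) w = \sum_i c i * h q (e i) w.
Proof.
by rewrite tensor_sym tensor_sumr; apply: eq_bigr => i _; rewrite tensor_sym.
Qed.

Lemma tensorZ (h : sym_tensor M) q (c d : R) (u w : 'rV[R]_n) :
  h q (c *: u) (d *: w) = c * d * h q u w.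
Proof.
have Zr (x y : 'rV[R]_n) (k : R) : h q x (k *: y) = k * h q x y.
  have lin := tensor_linear h (q := q) x.
  by have := lin k y 0; rewrite addr0 tensor0r addr0.
by rewrite Zr tensor_sym Zr tensor_sym mulrA (mulrC d).
Qed.

(** The pairings of [T u] with the frame are the entries of [u *m S], so the kernel of the form
    corresponds to the left null vectors of its Gram matrix. *)
Lemma degenerate_atP (h : sym_tensor M) q (T T' : 'rV[R]_n -> 'rV[R]_n) :
  (forall u, T u = \sum_i u 0 i *: T (delta_mx 0 i)) ->
  cancel T T' -> cancel T' T ->
  degenerate_at h q <->
  \det (\matrix_(i, j) h q (T (delta_mx 0 i)) (T (delta_mx 0 j))) = 0.
Proof.
move=> Tsum TK T'K; set S := (X in \det X).
have hT u j : h q (T u) (T (delta_mx 0 j)) = (u *m S) 0 j.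
  by rewrite Tsum tensor_suml mxE; apply: eq_bigr => i _; rewrite mxE.
have T0 : T 0 = 0 by rewrite Tsum big1// => i _; rewrite mxE scale0r.
split=> [[v v0 hv]|/eqP/det0P[u u0 uS]].
  apply/eqP/det0P; exists (T' v).
    by apply: contra_notN v0 => /eqP T'v; rewrite -(T'K v) T'v.
  by apply/rowP => j; rewrite -hT T'K hv mxE.
exists (T u).
  by move=> Tu; move/eqP: u0; apply; rewrite -(TK u) Tu -T0 TK.
move=> w; rewrite tensor_sym -(T'K w) Tsum tensor_suml big1// => j _.
by rewrite tensor_sym hT uS mxE mulr0.
Qed.

End Charts.

(** * Global smooth fields from a chart *)

Section BumpField.
Context (R : realType) (n : nat) (M : manifold R n).
Variables (phi : chart R n M) (a : 'rV[R]_n) (r : R).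
Hypotheses (aphi : atlas phi) (r0 : 0 < r)
  (sub_img : closed_ball a r `<=` chart_img phi).

(* The bump function is positive near its centre but nowhere normalized to 1: a
   local frame only has to be invertible, so no plateau is needed. *)
Definition bump_field (u : 'rV[R]_n) : vector_field M := fun q =>
  if `[< chart_dom phi q >]
  then flat_bump a r (phi q) *: (tangent_of phi q u : 'rV[R]_n) else 0.

Lemma bump_fieldE u q : chart_dom phi q ->
  bump_field u q = flat_bump a r (phi q) *: (tangent_of phi q u : 'rV[R]_n).
Proof. by move=> qphi; rewrite /bump_field asboolT. Qed.

Let supp : set M := chart_inv phi @` closed_ball a r.

(** A continuous image of a compact ball is compact, hence closed in the Hausdorff space [M]. The
    extension by zero thus has an open set to live on. *)
Let closed_supp : closed supp.
Proof.
apply: compact_closed; first exact: manifold_hausdorff.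
apply: continuous_compact; last first.
  apply: bounded_closed_compact; last exact: closed_ball_closed.
  exists (`|a| + r); split; first exact: num_real.
  move=> m am x; rewrite closed_ballE// /closed_ball_/= => ax.
  apply: le_trans (ltW am); rewrite -lerBlDl; apply: le_trans ax.
  by rewrite distrC lerB_dist.
apply: continuous_in_subspaceT => x; rewrite inE => /sub_img.
exact: chart_inv_continuous.
Qed.

Let bump_field_out u q : ~ supp q -> bump_field u q = 0 :> 'rV[R]_n.
Proof.
move=> nq; rewrite /bump_field; case: asboolP => // qphi.
have [->|b0] := eqVneq (flat_bump a r (phi q)) 0; first by rewrite scale0r.
by case: nq; exists (phi q); [exact: flat_bump_neq0 b0|exact: chart_mapK].
Qed.

(** Two local formulas cover every chart [psi]: the transition maps on the overlap with [phi], and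
    zero on the complement of [supp]. *)
Lemma smooth_bump_field u : smooth_field (bump_field u).
Proof.
move=> psi apsi k; apply: Ck_on_near_eq => _ [q qpsi <-].
have [qphi|nqphi] := pselect (chart_dom phi q).
  pose T := phi \o chart_inv psi.
  have oU : open (psi @` (chart_dom psi `&` chart_dom phi)).
    exact/open_chart_map/chart_dom_open.
  have Tk : Ck_on k (psi @` (chart_dom psi `&` chart_dom phi)) T.
    exact: atlas_compatible.
  (* One extra order is requested since the components of the field involve a derivative of the
     transition map. *)
  have [_ /(_ u) Dk] := atlas_compatible aphi apsi k.+1.
  have UU' x : (psi @` (chart_dom psi `&` chart_dom phi)) x ->
      (phi @` (chart_dom phi `&` chart_dom psi)) (T x).
    by move=> [q' [q'psi q'phi] <-]; exists q'; rewrite /T //= chart_mapK.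
  exists (psi @` (chart_dom psi `&` chart_dom phi)),
    (fun x => (flat_bump a r \o T) x *:
      ((fun y => 'D_u (psi \o chart_inv phi) y) \o T) x).
  split => //; first by exists q.
    apply: Ck_on_scale => //.
      by apply: (Ck_on_comp (U' := setT)) => //; exact: Ck_on_flat_bump.
    exact: (Ck_on_comp oU UU' Tk Dk).
  move=> _ [q' [q'psi q'phi] <-]; rewrite /T /= chart_mapK//.
  rewrite bump_fieldE// (tangent_coordZ _ _ apsi q'psi).
  by congr (_ *: _); exact: tangent_coord_of.
have nq : ~ supp q.
  by move=> [x /sub_img ximg xq]; apply: nqphi; rewrite -xq; exact: chart_inv_dom.
exists (psi @` (chart_dom psi `&` ~` supp)), (cst 0); split.
- exact/open_chart_map/closed_openC.
- by exists q.
- exact: Ck_on_cst.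
- move=> _ [q' [q'psi nq'] <-]; rewrite chart_mapK// bump_field_out//.
  by rewrite /tangent_coord derive0.
Qed.

End BumpField.

(** * Propagation of the degeneracy *)

(** The neighbourhood in the duality hypothesis may depend on the three fields; a single local frame
    supplies finitely many triples, so one neighbourhood serves them all. *)
Lemma degenerate_near (R : realType) (n : nat) (M : manifold R n)
    (h : sym_tensor M) (p : M) (nabla nabla' : connection M) :
  degenerate_at h p ->
  (forall X Y Z : vector_field M,
    smooth_field X -> smooth_field Y -> smooth_field Z ->
    \forall q \near p,
      act X (fun r => h r (Y r) (Z r)) q =
      h q (nabla X Y q) (Z q) + h q (Y q) (nabla' X Z q)) ->
  \forall q \near p, degenerate_at h q.
Proof.
move=> hp dual.
pose phi := chart_at p; pose a := phi p.
have aphi : atlas phi := chart_at_atlas p.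
have pphi : chart_dom phi p := chart_at_dom p.
have img_a : chart_img phi a := chart_img_map pphi.
have open_img := @chart_img_open _ _ _ phi.
have [r r0 sub_img] : exists2 r : R, 0 < r & closed_ball a r `<=` chart_img phi.
  have /nbhs_ballP[e /= e0 ae] := open_nbhs_nbhs (conj open_img img_a).
  exists (e / 2); first by rewrite divr_gt0.
  by apply: subset_trans ae; apply: closed_ball_subset; rewrite ?divr_gt0//; lra.
pose b := flat_bump a r.
pose E i := bump_field phi a r (delta_mx 0 i).
have smoothE i : smooth_field (E i) by exact: smooth_bump_field.
have Eu u q : chart_dom phi q -> bump_field phi a r u q =
    \sum_i u 0 i *: (E i q : 'rV[R]_n) :> 'rV[R]_n.
  move=> qphi; rewrite bump_fieldE// tangent_of_sum// scaler_sumr.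
  by apply: eq_bigr => i _; rewrite /E bump_fieldE// !scalerA mulrC.
(* Components in the frame [E], which is [b] times the coordinate frame; hence the inverse
   factor. *)
pose coord q (v : tangent q) := (b (phi q))^-1 *: tangent_coord phi v.
pose good q := chart_dom phi q /\ 0 < b (phi q).
pose S x := \matrix_(i, j) h (chart_inv phi x) (E i (chart_inv phi x))
  (E j (chart_inv phi x)).
have coordK q (v : tangent q) : good q -> bump_field phi a r (coord q v) q = v.
  move=> [qphi b0]; rewrite bump_fieldE// tangent_ofZ// tangent_coordK//.
  by rewrite scalerA mulfV ?scale1r// lt0r_neq0.
have degS q : good q -> degenerate_at h q <-> \det (S (phi q)) = 0.
  move=> gq; have [qphi b0] := gq.
  rewrite /S chart_mapK//.
  apply: (@degenerate_atP _ _ _ h q (bump_field phi a r ^~ q) (coord q)) => [u|u|v].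
  - exact: Eu.
  - rewrite /coord bump_fieldE// tangent_coordZ// tangent_ofK// scalerA mulVf ?scale1r//.
    exact: lt0r_neq0.
  - exact: coordK.
have near_good : \forall q \near p, good q.
  have nb : \forall q \near p, 0 < b (phi q).
    exact: (chart_map_continuous pphi (flat_bump_gt0_near a r0)).
  by apply: filterS2 nb (open_nbhs_nbhs (conj (@chart_dom_open _ _ _ phi) pphi)).
(* [S] is [b^2] times the Gram matrix of the coordinate frame, smooth by [tensor_smooth]. *)
have Sk k i j : Ck_on k (chart_img phi) (fun x => S x i j).
  have bk : Ck_on k (chart_img phi) b.
    exact: (Ck_on_subset (@subsetT _ _) (Ck_on_flat_bump a r k)).
  have Kk := tensor_smooth h aphi (delta_mx 0 i) (delta_mx 0 j) k.
  apply: Ck_on_eq (Ck_onM open_img (Ck_onM open_img bk bk) Kk) => // x ximg.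
  rewrite mxE /E !bump_fieldE; [|exact: chart_inv_dom..].
  by rewrite tensorZ chart_invK.
pose G k i x := tangent_coord phi (nabla (E k) (E i) (chart_inv phi x)).
pose G' k i x := tangent_coord phi (nabla' (E k) (E i) (chart_inv phi x)).
have Gc k i : Ck_on 0 (chart_img phi) (G k i).
  exact: (cov_smooth nabla (smoothE k) (smoothE i) aphi 0).
have G'c k i : Ck_on 0 (chart_img phi) (G' k i).
  exact: (cov_smooth nabla' (smoothE k) (smoothE i) aphi 0).
(* This is [tr A_k + tr B_k]. One inverse of [b] passes from chart to frame components, the other
   from the field [E k] to the coordinate direction. *)
pose c k x := (b x)^-1 * (b x)^-1 * \sum_i (G k i x 0 i + G' k i x 0 i).
have cc k : c k x @[x --> a] --> c k a.
  have bc : {for a, continuous b} := Ck_on_flat_bump a r 0 a Logic.I.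
  have b0 : b a != 0 by rewrite lt0r_neq0//; have [] := nbhs_singleton near_good.
  have bVc : (b x)^-1 @[x --> a] --> (b a)^-1 by exact: cvgV bc.
  have sc := (Ck_on_sum (index_enum _) open_img (fun i => Ck_onD open_img
    (Ck_on_coord i open_img (Gc k i)) (Ck_on_coord i open_img (G'c k i))) a img_a).
  exact: (cvgM (cvgM bVc bVc) sc).
have dS : \forall x \near a, [/\ chart_img phi x, 0 < b x &
    forall k i j, 'D_(delta_mx 0 k) (fun y => S y i j) x =
      (b x)^-1 * (b x)^-1 *
      (\sum_l G k i x 0 l * S x l j + \sum_l S x i l * G' k j x 0 l)].
  (* The three indices form one element of a finite type, so [filter_forall] intersects the
     neighbourhoods. *)
  have : \forall q \near p, forall kij : 'I_n * 'I_n * 'I_n,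
      act (E kij.1.1) (fun r => h r (E kij.1.2 r) (E kij.2 r)) q =
      h q (nabla (E kij.1.1) (E kij.1.2) q) (E kij.2 q) +
      h q (E kij.1.2 q) (nabla' (E kij.1.1) (E kij.2) q).
    by apply: filter_forall => kij; exact: dual.
  have invc : chart_inv phi x @[x --> a] --> p.
    by rewrite -[X in _ --> X](chart_mapK pphi); exact: chart_inv_continuous.
  move=> /invc near_dual; have near_good' := invc _ near_good.
  apply: filterS3 (open_nbhs_nbhs (conj open_img img_a)) near_dual near_good'.
  move=> x ximg dualx gx; have [qphi] := gx; rewrite chart_invK// => b0.
  split => // k i j; have := dualx (k, i, j); rewrite /=.
  set q := chart_inv phi x; have qx : phi q = x by rewrite chart_invK.
  have Sij : (fun r => h r (E i r) (E j r)) \o chart_inv phi = (fun y => S y i j).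
    by apply/funext => y; rewrite /= mxE.
  have dSij : differentiable (fun y => S y i j) x.
    by have [+ _] := Sk 1 i j; apply.
  rewrite (actE _ aphi qphi) Sij qx//.
  (* Since [E k] has components [b x] times the basis vector, its action is [b x] times the partial
     derivative. *)
  rewrite [X in tangent_coord _ X]bump_fieldE// tangent_coordZ// tangent_ofK// qx.
  rewrite deriveE// linearZ -deriveE//= -/b => bD.
  have expand (v : tangent q) :
      v = \sum_l coord q v 0 l *: (E l q : 'rV[R]_n) :> 'rV[R]_n.
    by rewrite -Eu// coordK.
  have hl (v : tangent q) m : h q v (E m q) = \sum_l coord q v 0 l * S x l m.
    rewrite {1}(expand v) (tensor_suml h q (coord q v 0) (fun l => E l q)).
    by apply: eq_bigr => l _; congr (_ * _); rewrite mxE.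
  have hr (v : tangent q) m : h q (E m q) v = \sum_l coord q v 0 l * S x m l.
    rewrite {1}(expand v) (tensor_sumr h q (coord q v 0) (fun l => E l q)).
    by apply: eq_bigr => l _; congr (_ * _); rewrite mxE.
  have b0' := lt0r_neq0 b0.
  apply: (mulfI b0'); rewrite [LHS]bD hl hr mulrA mulVKf// mulrDr !mulr_sumr.
  congr (_ + _); apply: eq_bigr => l _; rewrite /coord mxE qx -/b.
    by rewrite mulrA.
  by rewrite mulrAC mulrA.
have ddet : \forall x \near a, differentiable (fun y => \det (S y)) x /\
    forall v, `|'D_v (fun y => \det (S y)) x| <=
      (\sum_k (`|c k a| + 1)) * `|v| * `|\det (S x)|.
  (* The added 1 gives the strict inequality that continuity of [c k] at [a] propagates. *)
  have near_c : \forall x \near a, forall k : 'I_n, `|c k x| <= `|c k a| + 1.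
    pose bounded (k : 'I_n) x : Prop := `|c k x| <= `|c k a| + 1.
    apply: (@filter_forall _ _ bounded (nbhs a) (nbhs_filter a)) => k.
    have /cvgr_norm_le := cc k; apply.
    by rewrite ltrDl.
  apply: filterS2 dS near_c => x [ximg b0 dS] cx.
  have ddet : differentiable (fun y => \det (S y)) x.
    by have [+ _] := Ck_on_det open_img (Sk 1); apply.
  split => // v; rewrite derive_row_sum// -mulrA mulr_suml.
  apply: le_trans (ler_norm_sum _ _ _) _; apply: ler_sum => k _.
  have -> : 'D_(delta_mx 0 k) (fun y => \det (S y)) x = c k x * \det (S x).
    pose A := \matrix_(i, l) G k i x 0 l.
    pose B := \matrix_(l, j) G' k j x 0 l.
    have [] := @is_derive_det _ _ _ S
      ((b x)^-1 * (b x)^-1 *: (A *m S x + S x *m B)) x (delta_mx 0 k).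
      move=> i j; apply: DeriveDef.
        by apply: diff_derivable; have [+ _] := Sk 1 i j; apply.
      rewrite dS [in RHS]mxE [in RHS]mxE; congr (_ * (_ + _)).
        by rewrite mxE; apply: eq_bigr => l _; congr (_ * _); rewrite mxE.
      by rewrite mxE; apply: eq_bigr => l _; congr (_ * _); rewrite mxE.
    move=> _ ->; rewrite -scalemxAr mxtraceZ mxtrace_adj_mul mulrA.
    congr (_ * _ * _); rewrite -big_split; apply: eq_bigr => i _.
    by congr (_ + _); rewrite mxE.
  rewrite normrZ normrM !mulrA ler_wpM2r//.
  rewrite mulrC ler_pM//.
  (* For the maximum norm, each coordinate of [v] is bounded by the norm of [v]. *)
  rewrite [leRHS]/Num.Def.normr/= mx_normrE.
  exact: (le_bigmax _ (fun i => `|v i.1 i.2|) (0, k)).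
(* Degeneracy at [p] provides the initial value zero for Gronwall's argument. *)
have det0 : \forall x \near a, \det (S x) = 0.
  by apply: gradient_bound_eq0 ddet; apply/degS => //; exact: nbhs_singleton near_good.
have det0p : \forall q \near p, \det (S (phi q)) = 0.
  exact: (chart_map_continuous pphi det0).
by apply: filterS2 near_good det0p => q /degS[_ +].
Qed.

(** The equality at [p] is read as one of germs. For [h = x^2 dx^2] on the line, it holds at the
    single point 0 for all pairs of connections, both sides being zero there. *)
Theorem proposition2p5 (R : realType) (n : nat) (M : manifold R n)
    (h : sym_tensor M) (p : M)
    (h_degenerate : degenerate_at h p)
    (h_curve : exists (I : set R) (c : R -> M),
      [/\ open I /\ is_interval I, I 0, regular_curve I c, c 0 = p &
          forall t, I t -> 0 < t -> ~ degenerate_at h (c t)])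
    (nabla : connection M) :
  ~ exists nabla' : connection M,
      forall X Y Z : vector_field M,
        smooth_field X -> smooth_field Y -> smooth_field Z ->
        \forall q \near p,
          act X (fun r => h r (Y r) (Z r)) q =
          h q (nabla X Y q) (Z q) + h q (Y q) (nabla' X Z q).
Proof.
move=> [nabla' dual]; have deg := degenerate_near h_degenerate dual.
have [I [c [[openI _] I0 [[c_cont _] _] c0 nondeg]]] := h_curve.
(* Continuity of [c] at 0 pulls the neighbourhood of degenerate points back to parameters. *)
have degc : \forall t \near (0 : R), degenerate_at h (c t).
  by apply: c_cont I0 _ _; rewrite c0.
have /nbhs_ballP[e /= e0 ce] : \forall t \near (0 : R), degenerate_at h (c t) /\ I t.
  by apply: filterI degc _; exact: open_nbhs_nbhs.
have e20 : 0 < e / 2 by rewrite divr_gt0.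
have [degt It] : (degenerate_at h (c (e / 2)) /\ I (e / 2)).
  by apply: ce; rewrite -ball_normE /ball_/= sub0r normrN gtr0_norm//; lra.
exact: nondeg It e20 degt.
Qed.
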